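(* A 2-attractor is uniquely defined, up to affine similarity, by the spectrum of its matrix: if $M_1,M_2$ are integer expanding $d\times d$ matrices with $|\det M_1|=|\det M_2|=2$ having the same spectrum, and $D_1,D_2$ are admissible two-digit sets for $M_1$ and $M_2$ respectively, then the 2-attractors $G(M_1,D_1)$ and $G(M_2,D_2)$ are affinely similar.
   Context: An integer $d\times d$ matrix $M$ is called expanding if all its (complex) eigenvalues have modulus strictly greater than $1$. For an integer expanding $d\times d$ matrix $M$ with $|\det M|=2$, an admissible two-digit set is a set $D=\{\boldsymbol d_0,\boldsymbol d_1\}\subset\mathbb{Z}^d$ with $\boldsymbol d_1-\boldsymbol d_0\notin M\mathbb{Z}^d$. The 2-attractor generated by $M$ and $D$ is the compact set $G(M,D)=\{\sum_{k=1}^{\infty}M^{-k}\boldsymbol a_k : \boldsymbol a_k\in D \text{ for all } k\}\subset\mathbb{R}^d$. Two subsets of $\mathbb{R}^d$ are affinely similar if one is the image of the other under an invertible affine map of $\mathbb{R}^d$. The spectrum is the set of eigenvalues counted with multiplicity. *)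

(* Defs.v *)
From HB Require Import structures.
From mathcomp Require Import all_boot all_order all_algebra.
From mathcomp Require Import all_classical all_reals all_analysis.
From mathcomp Require Import complex.
Set Implicit Arguments.
Unset Strict Implicit.
Unset Printing Implicit Defensive.
Import Order.TTheory GRing.Theory Num.Theory numFieldNormedType.Exports.
Local Open Scope classical_set_scope.
Local Open Scope ring_scope.

(* The entries of an integer matrix M are cast into a ring S by map_mx intr M.
   The complex numbers are R[i], for R an arbitrary realType.                 *)

Definition expanding (R : realType) (d : nat) (M : 'M[int]_d) : Prop :=
  forall z : R[i], eigenvalue (map_mx intr M : 'M[R[i]]_d) z -> 1 < `|z|.

(* Algebraic multiplicity; it is 0 when z is not an eigenvalue. *)
Definition eigen_mult (R : realType) (d : nat) (M : 'M[int]_d) (z : R[i]) : nat :=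
  mup z (char_poly (map_mx intr M : 'M[R[i]]_d)).

Definition same_spectrum (R : realType) (d : nat) (M1 M2 : 'M[int]_d) : Prop :=
  forall z : R[i], eigen_mult M1 z = eigen_mult M2 z.

Definition admissible (d : nat) (M : 'M[int]_d) (D : set 'cV[int]_d) : Prop :=
  exists d0 d1 : 'cV[int]_d,
    D = [set d0; d1] /\ ~ exists z : 'cV[int]_d, d1 - d0 = M *m z.

(* The series starts at k = 0 here, hence the exponent k.+1. *)
Definition attractor (R : realType) (d : nat) (M : 'M[int]_d)
    (D : set 'cV[int]_d) : set 'cV[R]_d :=
  [set x : 'cV[R]_d | exists a : nat -> 'cV[int]_d, (forall k, D (a k)) /\
     series (fun k => invmx (map_mx intr M : 'M[R]_d) ^+ k.+1
                        *m (map_mx intr (a k) : 'cV[R]_d)) @ \oo --> x].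
Arguments attractor R [d] M D _.

Definition affinely_similar (R : realType) (d : nat) (X Y : set 'cV[R]_d) : Prop :=
  exists (A : 'M[R]_d) (b : 'cV[R]_d),
    A \in unitmx /\ Y = [set A *m x + b | x in X].

(* Main.v *)
(** Since the eigenvalues of M have modulus > 1, every nonconstant integer factor
    of its characteristic polynomial has constant term of modulus at least 2; as
    the constant term of the whole is +-2, Gauss's lemma makes it irreducible
    over Q.  Hence every nonzero rational vector is cyclic, and the difference
    vectors v1 and v2 of the two digit sets give Krylov bases in which M1 and M2
    have the same matrix.  The change of basis A satisfies A M1 = M2 A and
    A v1 = v2, so it carries one attractor onto the other up to a translation.  *)
Require Import Defs.
From mathcomp Require Import all_boot all_order all_algebra.
From mathcomp Require Import all_classical all_reals all_analysis.
From mathcomp Require Import complex.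
From mathcomp Require Import zify.
Set Implicit Arguments.
Unset Strict Implicit.
Unset Printing Implicit Defensive.
Import Order.TTheory GRing.Theory Num.Theory numFieldNormedType.Exports.
Local Open Scope classical_set_scope.
Local Open Scope ring_scope.

(** * Krylov bases and intertwiners *)

Section Krylov.
Variables (F : fieldType) (n : nat).
Implicit Types (M : 'M[F]_n.+1) (v : 'cV[F]_n.+1) (q : {poly F}).

Definition krylov M v : 'M[F]_n.+1 := \matrix_(i, j) (M ^+ j *m v) i 0.

Lemma horner_mx_mod_char_poly M q :
  horner_mx M (q %% char_poly M) = horner_mx M q.
Proof.
rewrite [in RHS](divp_eq q (char_poly M)) rmorphD rmorphM /=.
by rewrite Cayley_Hamilton mulr0 add0r.
Qed.

(** The coordinates of [horner_mx M q *m v] on the Krylov columns depend on [M] only through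
    [char_poly M]. This is what lets two matrices with equal characteristic polynomials be
    compared. *)
Lemma horner_mx_krylov M v q :
  horner_mx M q *m v = krylov M v *m \col_j (q %% char_poly M)`_j.
Proof.
rewrite -horner_mx_mod_char_poly.
have : (size (q %% char_poly M)%R <= n.+1)%N.
  by rewrite -ltnS -(size_char_poly M) ltn_modp -size_poly_eq0 size_char_poly.
move: (q %% _) => r szr.
have rE : r = \sum_(j < n.+1) r`_j *: 'X^j.
  rewrite -poly_def; apply/polyP => i; rewrite coef_poly.
  by case: ltnP => // ?; rewrite nth_default // (leq_trans szr).
rewrite {1}rE linear_sum mulmx_suml; apply/colP => i; rewrite summxE mxE.
apply: eq_bigr => j _; rewrite linearZ /= rmorphXn /= horner_mx_X -scalemxAl.
by rewrite !mxE mulrC.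
Qed.

(** A linear relation among the columns is a nonzero polynomial [q], of degree below that of
    [char_poly M], with [q(M) v = 0]. Irreducibility makes [q] coprime to [char_poly M], and a
    Bezout relation evaluated at [M] then forces [v = 0]. *)
Lemma krylov_unitmx M v :
  irreducible_poly (char_poly M) -> v != 0 -> krylov M v \in unitmx.
Proof.
move=> [_ irrM] v0; rewrite unitmxE unitfE -det_tr.
apply/negP => /det0P [w w0 wK].
pose q := \sum_(j < n.+1) w 0 j *: 'X^j.
have qE j : (q`_(nat_of_ord j)) = w 0 j.
  rewrite /q coef_sum (bigD1 j) //= coefZ coefXn eqxx mulr1 big1 ?addr0 //.
  move=> i; rewrite -val_eqE eq_sym => /negPf ij.
  by rewrite coefZ coefXn ij mulr0.
have szq : (size q < size (char_poly M))%N.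
  rewrite size_char_poly ltnS; apply: (leq_trans (size_sum _ _ _)).
  apply/bigmax_leqP => j _; apply: (leq_trans (size_scale_leq _ _)).
  by rewrite size_polyXn.
have q0 : q != 0.
  apply: contra_neq w0 => q0; apply/rowP => j.
  by rewrite -qE q0 coef0 mxE.
have qv : horner_mx M q *m v = 0.
  rewrite horner_mx_krylov modp_small //.
  have -> : \col_(j < n.+1) q`_j = w^T by apply/colP => j; rewrite !mxE qE.
  by apply: trmx_inj; rewrite trmx_mul trmxK wK trmx0.
have : coprimep q (char_poly M).
  rewrite coprimep_def; apply/idPn => sz1.
  have := irrM _ sz1 (dvdp_gcdr _ _) => /eqp_size e.
  by have := dvdp_leq q0 (dvdp_gcdl q (char_poly M)); rewrite e leqNgt szq.
case/Bezout_eq1_coprimepP => -[a b] /= ab1.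
move/eqP: v0; apply; rewrite -[v]mul1mx -[X in X *m _](rmorph1 (horner_mx M)).
by rewrite -ab1 rmorphD !rmorphM /= Cayley_Hamilton mulr0 addr0 -mulmxA qv mulmx0.
Qed.

(** [A] sends the Krylov basis of [v1] to that of [v2], hence [q(M1) v1] to [q(M2) v2] for every
    polynomial [q]. The intertwining relation is then checked on the basis [M1 ^+ j *m v1]. *)
Lemma irreducible_char_poly_intertwine M1 M2 v1 v2 :
    irreducible_poly (char_poly M1) -> char_poly M1 = char_poly M2 ->
    v1 != 0 -> v2 != 0 ->
  exists A, [/\ A \in unitmx, A *m M1 = M2 *m A & A *m v1 = v2].
Proof.
move=> irr1 eqp v10 v20.
have U1 := krylov_unitmx irr1 v10.
have U2 : krylov M2 v2 \in unitmx by apply: krylov_unitmx => //; rewrite -eqp.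
pose A := krylov M2 v2 *m invmx (krylov M1 v1).
have UA : A \in unitmx by rewrite unitmx_mul U2 unitmx_inv.
have AE q : A *m (horner_mx M1 q *m v1) = horner_mx M2 q *m v2.
  by rewrite !horner_mx_krylov /A -mulmxA mulKmx // eqp.
clearbody A; have AX k : A *m (M1 ^+ k *m v1) = M2 ^+ k *m v2.
  by have := AE 'X^k; rewrite !rmorphXn /= !horner_mx_X.
have powS M k v : M *m (M ^+ k *m v) = M ^+ k.+1 *m v by rewrite exprS -mulmxA.
exists A; split=> //.
- apply: (can_inj (mulmxK U1)).
  apply/matrixP => i j.
  have colE B : (B *m krylov M1 v1) i j = (B *m (M1 ^+ j *m v1)) i 0.
    by rewrite !mxE; apply: eq_bigr => k _; rewrite [krylov _ _ _ _]mxE.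
  by rewrite !colE -!mulmxA powS !AX powS.
- by have := AX 0; rewrite !expr0 !mul1mx.
Qed.

End Krylov.

(** * Geometric decay of matrix powers *)

Section GeometricDecay.
Variable C : numFieldType.
Implicit Types (u : nat -> C) (w : C) (s : seq C).

(** The constants live in [C] itself, so that complex eigenvalues are handled directly; [0 < r]
    makes [r] real. Strict positivity is what later gives a rate strictly above [|w|]. *)
Definition geometric_decay u :=
  exists c r, [/\ 0 < r, r < 1 & forall k, `|u k| <= c * r ^+ k].

Lemma geometric_decay0 : geometric_decay (fun=> 0).
Proof.
exists 0, 2^-1; split=> [||k]; rewrite ?invr_gt0 ?ltr0n //.
  by rewrite invf_lt1 ?ltr0n // ltr1n.
by rewrite normr0 mul0r.
Qed.

Lemma geometric_decay_shift w u : `|w| < 1 ->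
  geometric_decay (fun k => u k.+1 - w * u k) -> geometric_decay u.
Proof.
move=> w1 [c [r [r0 r1 ub]]].
have c0 : 0 <= c by have := le_trans (normr_ge0 _) (ub 0); rewrite expr0 mulr1.
(* A rate t < 1 with r <= t and |w| < t; C is only partially ordered, so no max. *)
pose t := r + `|w| * (1 - r).
have rt : r <= t by rewrite lerDl mulr_ge0 // subr_ge0 ltW.
have twE : t - `|w| = r * (1 - `|w|).
  by rewrite /t mulrBr mulr1 mulrBr mulr1 (mulrC r); rewrite addrA addrAC addrK.
have tw0 : 0 < t - `|w| by rewrite twE mulr_gt0 // subr_gt0.
have t0 : 0 < t := lt_le_trans r0 rt.
(* The first summand starts the induction; the second gives [c <= c' (t - |w|)], which is the
   inductive step. *)
pose c' := `|u 0| + c / (t - `|w|).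
have c'0 : 0 <= c' by rewrite addr_ge0 // divr_ge0 // ltW.
have cc' : c + `|w| * c' <= c' * t.
  rewrite -lerBrDr (mulrC _ c') -mulrBr /c' mulrDl divfK ?gt_eqF //.
  by rewrite lerDr mulr_ge0 // ltW.
exists c', t; split=> // [|k].
  rewrite -subr_gt0 /t opprD addrA -[X in X - _]mul1r -mulrBl.
  by rewrite mulr_gt0 // subr_gt0.
elim: k => [|k IH]; first by rewrite expr0 mulr1 lerDl divr_ge0 // ltW.
rewrite -(subrK (w * u k) (u k.+1)).
apply: le_trans (ler_normD _ _) _; rewrite normrM.
apply: le_trans (lerD (ub k) (ler_wpM2l (normr_ge0 w) IH)) _.
have : c * r ^+ k <= c * t ^+ k by rewrite ler_wpM2l // lerXn2r // nnegrE ltW.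
move=> /lerD -/(_ _ _ (lexx (`|w| * (c' * t ^+ k)))) /le_trans; apply.
by rewrite mulrA -mulrDl exprS mulrA ler_wpM2r // exprn_ge0 // ltW.
Qed.

(* The sequence N^k satisfies the linear recurrence given by char_poly N; its
   linear factors are peeled off one at a time with geometric_decay_shift.     *)
Lemma geometric_decay_expmx n (N : 'M[C]_n.+1) s :
    char_poly N = \prod_(w <- s) ('X - w%:P) -> (forall w, w \in s -> `|w| < 1) ->
  forall i j, geometric_decay (fun k => (N ^+ k) i j).
Proof.
move=> charN s1.
(* Quantifying over [q] lets the induction on [s] move one linear factor at a time from the product
   into [q]. *)
have peel q : (forall i j, geometric_decay
      (fun k => (horner_mx N (q * \prod_(w <- s) ('X - w%:P)) * N ^+ k) i j)) ->
    forall i j, geometric_decay (fun k => (horner_mx N q * N ^+ k) i j).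
  elim: s s1 q {charN} => [|w s IH] s1 q; first by rewrite big_nil mulr1.
  rewrite big_cons mulrA => /IH decay i j.
  apply: (@geometric_decay_shift w); first by rewrite s1 // mem_head.
  suff -> : (fun k => (horner_mx N q * N ^+ k.+1) i j
                       - w * (horner_mx N q * N ^+ k) i j)
          = (fun k => (horner_mx N (q * ('X - w%:P)) * N ^+ k) i j).
    by apply: decay => z zs; apply: s1; rewrite in_cons zs orbT.
  apply: funext => k.
  rewrite rmorphM rmorphB /= horner_mx_X horner_mx_C mulrBr mulrBl.
  rewrite exprS mulrA [RHS]mxE [X in _ = _ + X]mxE; congr (_ - _).
  by rewrite -[_ * w%:M]/(_ *m w%:M) mul_mx_scalar -scalerAl [RHS]mxE.
(* At [q = 1] the product is all of [char_poly N], so by Cayley-Hamilton the premise of [peel]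
   concerns the zero sequence. *)
have peel1 : forall i j, geometric_decay (fun k => (horner_mx N 1 * N ^+ k) i j).
  apply: peel => i j; rewrite mul1r -charN Cayley_Hamilton.
  by under eq_fun do rewrite mul0r mxE; exact: geometric_decay0.
by move=> i j; have := peel1 i j; under eq_fun do rewrite rmorph1 mul1r.
Qed.

End GeometricDecay.

(** * Entrywise convergence of matrices *)

Lemma mx_cvgP (R : realType) (m n : nat) (u : nat -> 'M[R]_(m, n)) (l : 'M[R]_(m, n)) :
  u @ \oo --> l <-> forall i j, (fun k => u k i j) @ \oo --> l i j.
Proof.
split=> [ul i j|ul].
  exact: (@continuous_cvg _ _ _ _ _ u (fun M : 'M[R]_(m, n) => M i j) _
    (@coord_continuous _ _ _ i j l) ul).
apply/cvg_ballP => e e0.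
have {}ul i j : \forall k \near \oo, ball (l i j) e (u k i j).
  exact: (cvg_ball (ul i j)).
(* There are finitely many entries, so the eventual bounds hold simultaneously. *)
suff: \forall k \near \oo, forall i j, ball (l i j) e (u k i j).
  by apply: filterS => k; split.
exact: filter_forall _ (fun i => filter_forall _ (ul i)).
Qed.

Lemma mulmx_cvg (R : realType) (m n p : nat) (u : nat -> 'M[R]_(m, n))
    (v : nat -> 'M[R]_(n, p)) (a : 'M[R]_(m, n)) (b : 'M[R]_(n, p)) :
  u @ \oo --> a -> v @ \oo --> b -> (fun k => u k *m v k) @ \oo --> a *m b.
Proof.
move=> /mx_cvgP ua /mx_cvgP vb; apply/mx_cvgP => i j.
rewrite mxE; under eq_fun do rewrite mxE.
apply: cvg_big => [|k _]; [exact: add_continuous | exact: cvgM].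
Qed.

(** * Algebra and dynamics of expanding integer matrices *)

Section Expanding.
Variables (R : realType).
Local Notation C := R[i].

(** Over [C] both monic polynomials split, and equal multiplicities make their root lists
    permutations of each other; injectivity of [intr] brings the equality back to the integers. *)
Lemma same_spectrum_char_poly n (M1 M2 : 'M[int]_n) :
  same_spectrum R M1 M2 -> char_poly M1 = char_poly M2.
Proof.
move=> spec; apply: (@map_inj_poly _ _ (intr : int -> C)); rewrite ?rmorph0 //.
  exact: intr_inj.
rewrite !map_char_poly.
have [r1 r1E] := closed_field_poly_normal (char_poly (map_mx intr M1 : 'M[C]_n)).
have [r2 r2E] := closed_field_poly_normal (char_poly (map_mx intr M2 : 'M[C]_n)).
move: r1E r2E; rewrite !(monicP (char_poly_monic _)) !scale1r => r1E r2E.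
rewrite r1E r2E; apply: perm_big; apply/allP => z _ /=.
by have := spec z; rewrite /eigen_mult r1E r2E !mu_prod_XsubC => ->.
Qed.

(** Up to sign the constant term is the leading coefficient, of modulus at least 1, times a nonempty
    product of roots of modulus above 1. *)
Lemma const_coef_gt1 (f : {poly int}) : (1 < size f)%N ->
    (forall z : C, root (map_poly intr f) z -> 1 < `|z|) -> 1 < `|f`_0|.
Proof.
move=> szf rootf; have f0 : f != 0 by rewrite -size_poly_gt0 ltnW.
have [r rE] := closed_field_poly_normal (map_poly intr f : {poly C}).
have lcE : lead_coef (map_poly intr f : {poly C}) = (lead_coef f)%:~R.
  by rewrite lead_coef_map_inj //; exact: intr_inj.
have r1 z : z \in r -> 1 < `|z|.
  move=> zr; apply: rootf; rewrite rE lcE rootZ ?root_prod_XsubC //.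
  by rewrite intr_eq0 lead_coef_eq0.
have lc1 : 1 <= `|(lead_coef f)%:~R : C|.
  by rewrite -intr_norm ler1z -gtz0_ge1 normr_gt0 lead_coef_eq0.
have szr : (0 < size r)%N.
  have : size (map_poly intr f : {poly C}) = size f.
    by rewrite size_map_inj_poly //; exact: intr_inj.
  rewrite rE lcE size_scale ?intr_eq0 ?lead_coef_eq0 // size_prod_XsubC.
  by case: r {rE r1} => //= e; rewrite -e in szf.
rewrite -(ltr1z C) intr_norm.
have -> : (f`_0)%:~R = (map_poly intr f : {poly C}).[0].
  by rewrite horner_coef0 coef_map.
rewrite rE lcE hornerZ normrM horner_prod normr_prod.
apply: lt_le_trans (ler_peMl _ lc1); last exact: prodr_ge0.
case: r szr r1 {rE} => // z r _ r1; rewrite big_cons.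
have prod1 : 1 <= \prod_(j <- r) `|('X - j%:P).[0]|.
  rewrite big_seq; elim/big_rec: _ => // w x wr x1.
  by rewrite hornerXsubC sub0r normrN mulr_ege1 // ltW // r1 // in_cons wr orbT.
rewrite hornerXsubC sub0r normrN; apply: (lt_le_trans (r1 z _)); first exact: mem_head.
by rewrite ler_peMr.
Qed.

Lemma expanding_root n (M : 'M[int]_n) (z : C) :
  expanding R M -> root (map_poly intr (char_poly M)) z -> 1 < `|z|.
Proof. by move=> expM; rewrite map_char_poly -eigenvalue_root_char; exact: expM. Qed.

Lemma irreducible_char_poly n (M : 'M[int]_n.+1) :
    expanding R M -> `|\det M| = 2 ->
  irreducible_poly (char_poly (map_mx intr M : 'M[rat]_n.+1)).
Proof.
move=> expM detM; rewrite -map_char_poly.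
set p := char_poly M.
have injQ : injective (intr : int -> rat) := intr_inj.
split=> [|q szq]; first by rewrite size_map_inj_poly // size_char_poly.
(* Gauss's lemma: the rational divisor [q] is a scalar multiple of an integer factor [f] of [p],
   with integer cofactor [g]. *)
case/dvdpP_rat_int => f [a a0 qE] [g pE].
have p0 : `|f`_0| * `|g`_0| = 2 :> int.
  rewrite -normrM -coef0M -pE char_poly_det normrM normrX normrN1 expr1n mul1r.
  exact: detM.
have pn0 : f * g != 0 by rewrite -pE monic_neq0 // char_poly_monic.
have [f0 g0] : f != 0 /\ g != 0 by apply/andP; rewrite -negb_or -mulf_eq0.
have szf : (1 < size f)%N.
  move: szq; rewrite qE size_scale // size_map_inj_poly //.
  by have := size_poly_gt0 f; rewrite f0; case: (size f) => [|[]].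
have rf z : root (map_poly intr f : {poly C}) z -> 1 < `|z|.
  move=> fz; apply: (expanding_root expM); rewrite -/p pE rmorphM rootM.
  by rewrite fz.
have rg z : root (map_poly intr g : {poly C}) z -> 1 < `|z|.
  move=> gz; apply: (expanding_root expM); rewrite -/p pE rmorphM rootM.
  by rewrite gz orbT.
have [szg|szg] := leqP (size g) 1; last first.
  have lt2 (x y : int) : 1 < x -> 1 < y -> x * y = 2 -> False by nia.
  by case: (lt2 _ _ (const_coef_gt1 szf rf) (const_coef_gt1 szg rg) p0).
(* The cofactor is a nonzero constant, so [q] and [p] are associates over the rationals. *)
have gE := size1_polyC szg; move: (g`_0) gE => b gE.
have b0 : b != 0 by rewrite gE polyC_eq0 in g0.
rewrite qE pE gE rmorphM /= map_polyC /= mulrC mul_polyC.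
by rewrite (eqp_ltrans (eqp_scale _ a0)) eqp_sym eqp_scale // intr_eq0.
Qed.

(** The determinant is an integer, so its vanishing can be tested over [C], where it would make 0 an
    eigenvalue. *)
Lemma expanding_unitmx n (M : 'M[int]_n) (F : numFieldType) :
  expanding R M -> (map_mx intr M : 'M[F]_n) \in unitmx.
Proof.
move=> expM; rewrite unitmxE unitfE det_map_mx intr_eq0 -(@intr_eq0 C).
rewrite -det_map_mx; apply/negP => /det0P [v v0 vM].
have /expM : eigenvalue (map_mx intr M : 'M[C]_n) 0.
  by apply/eigenvalueP; exists v; rewrite ?scale0r.
by rewrite normr0 ltr10.
Qed.

(** A real vector fixed by [M] would give the complex eigenvalue 1. Invertibility is what makes the
    equation for the translation vector solvable. *)
Lemma expanding_sub1_unitmx n (M : 'M[int]_n) :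
  expanding R M -> (map_mx intr M - 1%:M : 'M[R]_n) \in unitmx.
Proof.
move=> expM; rewrite unitmxE unitfE; apply/negP => /det0P [v v0].
rewrite mulmxBr mulmx1 => /eqP; rewrite subr_eq0 => /eqP vM.
have : eigenvalue (map_mx intr M : 'M[C]_n) 1.
  apply/eigenvalueP; exists (map_mx (real_complex R) v); last first.
    by rewrite map_mx_eq0.
  rewrite scale1r -[in RHS]vM map_mxM -map_mx_comp; congr (_ *m _).
  by apply/matrixP => i j; rewrite !mxE /= rmorph_int.
by move/expM; rewrite normr1 ltxx.
Qed.

Lemma expanding_invmx_eigenvalue n (M : 'M[int]_n) (z : C) :
    expanding R M ->
  eigenvalue (invmx (map_mx intr M)) z -> `|z| < 1.
Proof.
move=> expM /eigenvalueP [v vN v0].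
have UM := expanding_unitmx C expM.
have vE : v = z *: (v *m map_mx intr M) by rewrite scalemxAl -vN mulmxKV.
have z0 : z != 0 by apply: contra_neq v0 => z0; rewrite vE z0 scale0r.
have : eigenvalue (map_mx intr M : 'M[C]_n) z^-1.
  by apply/eigenvalueP; exists v => //; rewrite [in RHS]vE scalerA mulVf ?scale1r.
by move/expM; rewrite normfV invf_gt1 // normr_gt0.
Qed.

Lemma expanding_invmx_expn_cvg0 n (M : 'M[int]_n.+1) :
    expanding R M ->
  (fun k => invmx (map_mx intr M : 'M[R]_n.+1) ^+ k) @ \oo --> (0 : 'M[R]_n.+1).
Proof.
move=> expM; apply/mx_cvgP => i j; rewrite mxE.
pose N : 'M[C]_n.+1 := invmx (map_mx intr M).
have [s sE] := closed_field_poly_normal (char_poly N).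
rewrite (monicP (char_poly_monic _)) scale1r in sE.
have s1 w : w \in s -> `|w| < 1.
  move=> ws; apply: (expanding_invmx_eigenvalue expM).
  by rewrite eigenvalue_root_char -/N sE root_prod_XsubC.
have [c [r [r0 r1 Nk]]] := geometric_decay_expmx sE s1 i j.
have NE : N = map_mx (real_complex R) (invmx (map_mx intr M)).
  rewrite map_invmx -map_mx_comp; congr invmx.
  by apply/matrixP => ? ?; rewrite !mxE /= rmorph_int.
(* The bound was obtained over [C]; its constants are nonnegative, hence real, so it descends to the
   real matrix. *)
have rE : r = (complex.Re r)%:C%C by rewrite RRe_real // gtr0_real.
have c0 : 0 <= c by have := le_trans (normr_ge0 _) (Nk 0); rewrite expr0 mulr1.
have cE : c = (complex.Re c)%:C%C by rewrite RRe_real // ger0_real.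
move: (complex.Re r) (complex.Re c) rE cE => rho gam rE cE.
rewrite rE cE ltcR in Nk r0 r1 *.
have {}Nk k : `|(invmx (map_mx intr M : 'M[R]_n.+1) ^+ k) i j| <= gam * rho ^+ k.
  have := Nk k; rewrite NE -rmorphXn mxE.
  by rewrite normc_def /= expr0n addr0 sqrtr_sqr -rmorphXn -rmorphM lecR.
have geo : (fun k => gam * rho ^+ k) @ \oo --> (0 : R).
  by apply: cvg_geometric; rewrite gtr0_norm // -ltcR.
apply/norm_cvg0P.
apply: (squeeze_cvgr _ (cvg_cst 0) geo).
by near=> k; rewrite normr_ge0 Nk.
Unshelve. all: by end_near. Qed.

End Expanding.

(* b is the fixed point making the constant digit discrepancy e0 - A d0 telescope:
   N2^(k+1) (M2 - 1) b = N2^k b - N2^(k+1) b, where N2 = M2^-1.                  *)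
Lemma attractor_affine_image (R : realType) (n : nat) (M1 M2 : 'M[int]_n.+1)
    (d0 d1 e0 e1 : 'cV[int]_n.+1) (A : 'M[R]_n.+1) (b : 'cV[R]_n.+1) :
    expanding R M1 -> expanding R M2 ->
    A *m map_mx intr M1 = map_mx intr M2 *m A ->
    A *m map_mx intr (d1 - d0) = map_mx intr (e1 - e0) ->
    (map_mx intr M2 - 1%:M) *m b = map_mx intr e0 - A *m map_mx intr d0 ->
  forall x, attractor R M1 [set d0; d1] x ->
    attractor R M2 [set e0; e1] (A *m x + b).
Proof.
move=> exp1 exp2 AM Av bE x [a [aD ax]].
have U1 := expanding_unitmx R exp1; have U2 := expanding_unitmx R exp2.
set N1 := invmx _ in ax; pose N2 : 'M[R]_n.+1 := invmx (map_mx intr M2).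
have AN : A *m N1 = N2 *m A.
  by apply: (can_inj (mulmxK U1)); rewrite mulmxKV // -mulmxA AM mulKmx.
have ANk k : A *m N1 ^+ k = N2 ^+ k *m A.
  elim: k => [|k IH]; first by rewrite !expr0 mulmx1 mul1mx.
  by rewrite !exprS mulmxA AN -mulmxA IH mulmxA.
pose a' k := if a k == d0 then e0 else e1.
(* The same affine map relates both digit pairs, because [A] sends [d1 - d0] to [e1 - e0]. *)
have a'E k : map_mx intr (a' k)
    = A *m map_mx intr (a k) + (map_mx intr M2 - 1%:M) *m b :> 'cV[R]_n.+1.
  rewrite bE /a'; case: eqP => [->|]; first by rewrite addrC subrK.
  case: (aD k) => // -> _; move: Av; rewrite !map_mxB mulmxBr => /eqP.
  by rewrite subr_eq => /eqP ->; rewrite [X in _ = _ + X]addrC addrA addrK subrK.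
have termE k : N2 ^+ k.+1 *m map_mx intr (a' k) =
    A *m (N1 ^+ k.+1 *m map_mx intr (a k)) - (N2 ^+ k.+1 *m b - N2 ^+ k *m b).
  rewrite a'E mulmxDr !mulmxA ANk; congr (_ + _).
  rewrite mulmxBr mulmx1 mulmxBl opprB exprSr.
  by rewrite -[(_ * N2)]/(_ *m N2) mulmxKV.
exists a'; split=> [k|]; first by rewrite /a'; case: ifP => _; [left | right].
have -> : series (fun k => N2 ^+ k.+1 *m map_mx intr (a' k))
    = (fun k => A *m series (fun k => N1 ^+ k.+1 *m map_mx intr (a k)) k
                 + (b - N2 ^+ k *m b)).
  apply: funext => k; rewrite /series /=.
  under eq_bigr do rewrite termE.
  rewrite sumrB mulmx_sumr telescope_sumr // expr0 mul1mx.
  by rewrite opprB.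
(* The boundary term [N2 ^+ k *m b] of the telescoping tends to 0, which leaves the translation
   [b]. *)
apply: cvgD; first by apply: mulmx_cvg => //; exact: cvg_cst.
rewrite -[X in _ --> X]subr0; apply: cvgB; first exact: cvg_cst.
rewrite -(mul0mx _ b); apply: mulmx_cvg; last exact: cvg_cst.
exact: expanding_invmx_expn_cvg0.
Qed.

Theorem theorem1 (R : realType) (d : nat) (M1 M2 : 'M[int]_d)
    (D1 D2 : set 'cV[int]_d)
    (expM1 : expanding R M1) (expM2 : expanding R M2)
    (detM1 : `|\det M1| = 2) (detM2 : `|\det M2| = 2)
    (specM : same_spectrum R M1 M2)
    (admD1 : admissible M1 D1) (admD2 : admissible M2 D2) :
  affinely_similar (attractor R M1 D1) (attractor R M2 D2).
Proof.
case: d => [|n] in M1 M2 D1 D2 expM1 expM2 detM1 detM2 specM admD1 admD2 *.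
  (* In dimension 0 the determinant is 1, not of modulus 2. *)
  by move: detM1; rewrite det_mx00.
case: admD1 => d0 [d1 [-> d01]]; case: admD2 => e0 [e1 [-> e01]].
have nz (M : 'M[int]_n.+1) (v : 'cV[int]_n.+1) :
    ~ (exists z, v = M *m z) -> map_mx intr v != 0 :> 'cV[rat]_n.+1.
  move=> vM; apply/eqP => v0; apply: vM; exists 0; rewrite mulmx0.
  apply/colP => i; move/colP/(_ i): v0; rewrite !mxE => /eqP.
  by rewrite intr_eq0 => /eqP.
have charQ : char_poly (map_mx intr M1 : 'M[rat]_n.+1) = char_poly (map_mx intr M2).
  by rewrite -!map_char_poly (same_spectrum_char_poly specM).
(* Irreducibility holds over the rationals, so the intertwiner is built there and cast to [R]
   afterwards. *)
have [A [UA AM Av]] := irreducible_char_poly_intertwine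
  (irreducible_char_poly expM1 detM1) charQ (nz _ _ d01) (nz _ _ e01).
have ratr_intr m p (B : 'M[int]_(m, p)) :
    map_mx ratr (map_mx intr B : 'M[rat]_(m, p)) = map_mx intr B :> 'M[R]_(m, p).
  by rewrite -map_mx_comp; apply/matrixP => i j; rewrite !mxE /= ratr_int.
pose B : 'M[R]_n.+1 := map_mx ratr A.
have UB : B \in unitmx by rewrite map_unitmx.
have BM : B *m map_mx intr M1 = map_mx intr M2 *m B.
  by rewrite -!ratr_intr -!map_mxM AM.
have Bv : B *m map_mx intr (d1 - d0) = map_mx intr (e1 - e0).
  by rewrite -!ratr_intr -map_mxM Av.
clearbody B.
pose b : 'cV[R]_n.+1 := invmx (map_mx intr M2 - 1%:M)
          *m (map_mx intr e0 - B *m map_mx intr d0).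
have bE : (map_mx intr M2 - 1%:M) *m b = map_mx intr e0 - B *m map_mx intr d0.
  by rewrite mulKVmx // expanding_sub1_unitmx.
clearbody b.
exists B, b; split=> //; apply/seteqP; split=> [y yY|_ [x xX <-]]; last first.
  exact: (attractor_affine_image expM1 expM2 BM Bv bE xX).
(* The reverse inclusion is the same lemma with the two matrices exchanged, for the inverse map of
   linear part [invmx B] and translation [- invmx B *m b]. *)
exists (invmx B *m y - invmx B *m b); last by rewrite mulmxBr !mulKVmx // subrK.
have BM' : invmx B *m map_mx intr M2 = map_mx intr M1 *m invmx B.
  by apply: (can_inj (mulmxK UB)); rewrite mulmxKV // -mulmxA -BM mulKmx.
apply: (attractor_affine_image expM2 expM1 BM' _ _ yY).
  by rewrite -Bv mulKmx.
rewrite mulmxN mulmxBl mul1mx mulmxA -BM' -mulmxA -mulmxBr.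
rewrite -[X in _ - X]mul1mx -mulmxBl bE mulmxBr mulKmx //.
by rewrite opprB.
Qed.
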